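(* Let $X$ be a uniformly convex Banach space, let $\eta$ be a modulus of uniform convexity for $X$, and let $T:X\to X$ be a linear operator with $\|Tx\|\le\|x\|$ for all $x\in X$. Let $b>0$. Then for all $x\in X$ with $\|x\|\le b$, writing $x_n:=\frac1n\sum_{i=0}^{n-1}T^ix$ ($n\ge 1$), the following holds: for every $\varepsilon>0$ and every $g:\mathbb{N}\to\mathbb{N}$ there exists $P\in\mathbb{N}$ with $P\le\Phi(\varepsilon,g,b,\eta)$ such that $$\|x_i-x_j\|<\varepsilon\quad\text{for all integers } i,j\in[P,P+g(P)],$$ where $$\Phi(\varepsilon,g,b,\eta):=M\cdot\tilde h^{K}(1),$$ with $$M:=\left\lceil\frac{16b}{\varepsilon}\right\rceil,\qquad \gamma:=\frac{\varepsilon}{16}\,\eta\!\left(\frac{\varepsilon}{8b}\right),\qquad K:=\left\lceil\frac{b}{\gamma}\right\rceil,$$ $$h,\tilde h:\mathbb{N}\to\mathbb{N},\qquad h(n):=2\bigl(Mn+g(Mn)\bigr),\qquad \tilde h(n):=\max_{1\le i\le n}h(i),$$ and $\tilde h^{K}$ denotes the $K$-fold iterate of $\tilde h$. Moreover, if $\eta$ can be written as $\eta(\varepsilon)=\varepsilon\cdot\tilde\eta(\varepsilon)$ (for $\varepsilon\in(0,2]$) with a function $\tilde\eta:(0,\infty)\to(0,\infty)$ such that $0<\varepsilon_1\le\varepsilon_2$ implies $\tilde\eta(\varepsilon_1)\le\tilde\eta(\varepsilon_2)$, then the same conclusion holds with $\gamma$ replaced by $\gamma:=\frac{\varepsilon}{8}\,\tilde\eta\!\left(\frac{\varepsilon}{8b}\right)$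 (all other definitions, including $M$ and $K=\lceil b/\gamma\rceil$, unchanged in form).
   Context: $\mathbb{N}=\{1,2,3,\ldots\}$. A Banach space $X$ is uniformly convex if for all $\varepsilon\in(0,2]$ there exists $\delta\in(0,1]$ such that for all $x,y\in X$: $\|x\|\le1$, $\|y\|\le 1$ and $\|x-y\|\ge\varepsilon$ imply $\left\|\frac12(x+y)\right\|\le 1-\delta$. A modulus of uniform convexity for $X$ is a mapping $\eta:(0,2]\to(0,1]$ such that for each $\varepsilon\in(0,2]$ the number $\delta:=\eta(\varepsilon)$ has this property. Convention: a modulus $\eta$ is extended to all $\varepsilon>0$ by $\eta(\varepsilon):=\eta(\min(2,\varepsilon))$, if it is not already defined for $\varepsilon>2$. *)

(* Defs.v *)
From mathcomp Require Import all_boot all_order all_algebra.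
From mathcomp Require Import all_classical all_reals all_analysis.
Set Implicit Arguments.
Unset Strict Implicit.
Unset Printing Implicit Defensive.
Import Order.TTheory GRing.Theory Num.Theory.
Import numFieldNormedType.Exports.
Local Open Scope ring_scope.

(* The positive integers are represented by [nat]: functions N -> N are
   functions [nat -> nat] that are positive at positive arguments, and their
   value at 0 is never used. *)

Definition convexity_gap (R : realType) (X : normedModType R)
    (eps delta : R) : Prop :=
  forall x y : X, `|x| <= 1 -> `|y| <= 1 -> eps <= `|x - y| ->
    `|(2^-1 : R) *: (x + y)| <= 1 - delta.

Definition uniformly_convex (R : realType) (X : normedModType R) : Prop :=
  forall eps : R, 0 < eps <= 2 ->
    exists2 delta : R, 0 < delta <= 1 & convexity_gap X eps delta.

(* Only the values of [eta] on (0, 2] are constrained. *)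
Definition convexity_modulus (R : realType) (X : normedModType R)
    (eta : R -> R) : Prop :=
  forall eps : R, 0 < eps <= 2 ->
    0 < eta eps <= 1 /\ convexity_gap X eps (eta eps).

Definition extend_modulus (R : realType) (eta : R -> R) (eps : R) : R :=
  eta (Num.min 2 eps).

Definition ergodic_average (R : realType) (X : normedModType R) (T : X -> X)
    (x : X) (n : nat) : X :=
  (n%:R^-1 : R) *: \sum_(0 <= i < n) iter i T x.

(* [absz] only casts to [nat]; the arguments used below are positive. *)
Definition ceil_nat (R : realType) (r : R) : nat := `|Num.ceil r|%N.

Section Bound.
Variables (R : realType) (eps : R) (g : nat -> nat) (b gamma : R).

Definition bound_M : nat := ceil_nat (16 * b / eps).

Definition bound_K : nat := ceil_nat (b / gamma).

Definition bound_h (n : nat) : nat :=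
  (2 * (bound_M * n + g (bound_M * n)))%N.

Definition bound_htilde (n : nat) : nat :=
  (\max_(1 <= i < n.+1) bound_h i)%N.

Definition Phi : nat := (bound_M * iter bound_K bound_htilde 1)%N.

End Bound.

Definition gamma_modulus (R : realType) (eta : R -> R) (eps b : R) : R :=
  eps / 16 * extend_modulus eta (eps / (8 * b)).

Definition gamma_factored (R : realType) (etat : R -> R) (eps b : R) : R :=
  eps / 8 * etat (eps / (8 * b)).

(* [gamma eps b] is the value of gamma at the given eps and b. *)
Definition ergodic_metastable (R : realType) (X : normedModType R)
    (T : X -> X) (b : R) (gamma : R -> R -> R) : Prop :=
  forall x : X, `|x| <= b ->
  forall eps : R, 0 < eps ->
  forall g : nat -> nat, (forall n, (0 < n)%N -> (0 < g n)%N) ->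
  exists P : nat,
    [/\ (0 < P)%N,
        (P <= Phi eps g b (gamma eps b))%N &
        forall i j : nat, (P <= i <= P + g P)%N -> (P <= j <= P + g P)%N ->
          `|ergodic_average T x i - ergodic_average T x j| < eps].

(* Main.v *)
(** Let [x_n] be the averages. As [T] is a contraction,
    [|x_(2kn)| <= |(x_n + T^(kn) x_n) / 2|], so uniform convexity makes the norm
    drop by [gamma] from [x_n] to [x_(2kn)] as soon as [T^(kn) x_n] is at
    distance at least [eps / 8] from [x_n]. Such a drop can happen at most [K]
    times in a row; hence for some [N <= htilde^K(1)] no [x_m] with [m <= h N] has
    norm at most [|x_N| - gamma]. Then all [T^(kN) x_N] with
    [kN <= MN + g (MN)] are within [eps / 8] of [x_N], hence so are the
    [x_(kN)], and any [x_i] with [i] in [[MN, MN + g (MN)]] is within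
    [2b / M <= eps / 8] of [x_(kN)] for [k = i %/ N]. *)
Require Import Defs.
From mathcomp Require Import all_boot all_order all_algebra.
From mathcomp Require Import all_classical all_reals all_analysis.
From mathcomp Require Import zify ring lra.
Import Order.TTheory GRing.Theory Num.Theory.
Import numFieldNormedType.Exports.
Local Open Scope ring_scope.

Set Implicit Arguments.
Unset Strict Implicit.
Unset Printing Implicit Defensive.

Lemma le_ceil_nat (R : realType) (r : R) : 0 <= r -> r <= (ceil_nat r)%:R.
Proof.
move=> r0; rewrite /ceil_nat natr_absz ger0_norm ?ceil_ge //.
by rewrite ceil_ge0 (lt_le_trans _ r0) // oppr_lt0.
Qed.

Lemma ceil_nat_gt0 (R : realType) (r : R) : 0 < r -> (0 < ceil_nat r)%N.
Proof. by move=> r0; rewrite -(ltr0n R) (lt_le_trans r0) // le_ceil_nat // ltW. Qed.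

(** * Uniform convexity in balls of arbitrary radius *)

Section UniformConvexity.
Variables (R : realType) (X : normedModType R) (eta : R -> R).
Hypothesis heta : convexity_modulus X eta.

(** Dividing by [|v|] moves both vectors into the unit ball, at distance at least [e]. *)
Lemma midpoint_le (e : R) (u v : X) : `|u| <= `|v| -> v != 0 ->
  0 < e <= 2 -> e * `|v| <= `|u - v| ->
  `|(2^-1 : R) *: (u + v)| <= `|v| - `|v| * eta e.
Proof.
move=> uv v0 he euv; have nv : 0 < `|v| by rewrite normr_gt0.
have [_ gap] := heta he.
have nZ (w : X) : `|(`|v|^-1 : R) *: w| = `|w| / `|v|.
  by rewrite normrZ ger0_norm ?invr_ge0 ?ltW // mulrC.
have := gap (`|v|^-1 *: u) (`|v|^-1 *: v).
rewrite -scalerBr -scalerDr scalerA mulrC -scalerA !nZ.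
rewrite !ler_pdivrMr // ler_pdivlMr // !mul1r => /(_ uv (lexx _) euv).
by rewrite mulrBl mul1r [eta e * _]mulrC.
Qed.

(** The two drops serve the two choices of gamma. [eta] need not be monotone, so neither implies the
    other: one uses the separation relative to [b], the other relative to [|v|]. *)
Lemma midpoint_le_bounded (b e : R) (u v : X) : 0 < b -> 0 < e ->
  `|u| <= `|v| -> `|v| <= b -> e <= `|u - v| ->
  [/\ e <= 2 * `|v|,
      `|(2^-1 : R) *: (u + v)| <= `|v| - e / 2 * extend_modulus eta (e / b) &
      `|(2^-1 : R) *: (u + v)| <= `|v| - `|v| * eta (e / `|v|)].
Proof.
move=> b0 e0 uv vb euv.
have e2v : e <= 2 * `|v| by have := ler_normB u v; lra.
have v_gt0 : 0 < `|v| by lra.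
have v0 : v != 0 by rewrite -normr_gt0.
have eb : 0 < e / b <= 2 by rewrite divr_gt0 //= ler_pdivrMr //; lra.
have [etab _] := heta eb.
split => //.
  have -> : extend_modulus eta (e / b) = eta (e / b).
    by rewrite /extend_modulus min_r //; case/andP: eb.
  apply: (@le_trans _ _ (`|v| - `|v| * eta (e / b))).
    apply: midpoint_le => //; apply: le_trans euv.
    by rewrite mulrAC ler_pdivrMr // ler_pM2l.
  (* The factor [e / 2] is the lower bound on [|v|]. *)
  by rewrite lerB // ler_wpM2r //; [case/andP: etab => /ltW | lra].
apply: midpoint_le => //; first by rewrite divr_gt0 //= ler_pdivrMr.
by rewrite divfK // gt_eqF.
Qed.

End UniformConvexity.

(** * Orbit sums and averages of a linear contraction *)

Section Averages.
Variables (R : realType) (X : normedModType R) (T : {linear X -> X}).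
Hypothesis hT : forall x : X, `|T x| <= `|x|.
Implicit Types (x y : X).

Lemma iter_linearD n x y : iter n T (x + y) = iter n T x + iter n T y.
Proof. by elim: n => //= n ->; rewrite linearD. Qed.

Lemma iter_linearZ n (c : R) x : iter n T (c *: x) = c *: iter n T x.
Proof. by elim: n => //= n ->; rewrite linearZ. Qed.

Lemma norm_iter_le n x : `|iter n T x| <= `|x|.
Proof. by elim: n => //= n IH; apply: le_trans IH. Qed.

(** Unnormalised sums keep the identities free of division and valid at [n = 0]. *)
Let psum x n := \sum_(0 <= i < n) iter i T x.

Lemma psumD x y n : psum (x + y) n = psum x n + psum y n.
Proof. by rewrite -big_split; apply: eq_bigr => i _; rewrite iter_linearD. Qed.

Lemma iter_psum x m n : iter m T (psum x n) = psum (iter m T x) n.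
Proof.
elim: n => [|n IH]; last first.
  by rewrite /psum !big_nat_recr //= iter_linearD -iterD addnC iterD IH.
by rewrite /psum !big_geq //; elim: m => //= m ->; rewrite linear0.
Qed.

Lemma psum_add x m n : psum x (m + n) = psum x m + iter m T (psum x n).
Proof.
rewrite iter_psum /psum (@big_cat_nat _ _ _ m) ?leq_addr //=; congr (_ + _).
rewrite (big_addn 0 _ m) addKn.
by apply: eq_bigr => i _; rewrite iterD.
Qed.

Lemma psum_mul x k n :
  psum x (k * n) = \sum_(0 <= j < k) iter (j * n) T (psum x n).
Proof.
elim: k => [|k IH]; first by rewrite mul0n /psum !big_geq.
by rewrite mulSnr psum_add IH big_nat_recr.
Qed.

Lemma norm_psum_le x n : `|psum x n| <= n%:R * `|x|.
Proof.
apply: le_trans (ler_norm_sum _ _ _) _.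
rewrite mulr_natl -[n in leRHS]subn0 -sumr_const_nat.
by apply: ler_sum => i _; exact: norm_iter_le.
Qed.

Lemma psumE x n : psum x n = n%:R *: ergodic_average T x n.
Proof.
case: n => [|n]; first by rewrite scale0r /psum big_geq.
by rewrite /ergodic_average scalerA divff ?scale1r // pnatr_eq0.
Qed.

Lemma norm_average_le x n : `|ergodic_average T x n| <= `|x|.
Proof.
case: n => [|n]; first by rewrite /ergodic_average invr0 scale0r normr0.
have := norm_psum_le x n.+1.
by rewrite psumE normrZ normr_nat ler_pM2l // ltr0n.
Qed.

(** Cut the sum of [2kn] terms into blocks of length [n] and pair block [j] with block [j + k]: each
    pair is [T^(jn)] applied to [2n u], so its norm is at most [2n |u|]. *)
Lemma norm_average_double_le x k n : (0 < k)%N -> (0 < n)%N ->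
  `|ergodic_average T x (2 * (k * n))| <=
  `|(2^-1 : R) *: (iter (k * n) T (ergodic_average T x n) +
                   ergodic_average T x n)|.
Proof.
move=> k0 n0; set u := (2^-1 : R) *: _.
have : psum x (2 * (k * n)) =
    \sum_(0 <= j < k) iter (j * n) T ((2 * n%:R) *: u).
  have -> : (2 * n%:R) *: u = psum (x + iter (k * n) T x) n.
    rewrite /u scalerA mulrAC divff ?pnatr_eq0 // mul1r psumD -iter_psum psumE.
    by rewrite scalerDr addrC -iter_linearZ.
  by rewrite -psum_mul mul2n -addnn psum_add iter_psum -psumD.
rewrite psumE => /(congr1 (fun y : X => `|y|)); rewrite normrZ normr_nat => E.
have : (2 * (k * n))%:R * `|ergodic_average T x (2 * (k * n))| <=
    (2 * (k * n))%:R * `|u|.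
  rewrite E; apply: le_trans (ler_norm_sum _ _ _) _.
  have -> : (2 * (k * n))%:R * `|u| = \sum_(0 <= j < k) `|(2 * n%:R : R) *: u|.
    rewrite sumr_const_nat subn0 -[RHS]mulr_natl [in RHS]normrZ ger0_norm ?mulr_ge0 //.
    by rewrite !natrM; ring.
  by apply: ler_sum => j _; exact: norm_iter_le.
by rewrite ler_pM2l // ltr0n !muln_gt0 k0 n0.
Qed.

(** The average over [kn] terms is the mean over [j < k] of [T^(jn)] applied to the average over [n]
    terms. *)
Lemma average_mul_dist_le x k n (e : R) : (0 < k)%N -> (0 < n)%N ->
  (forall j, (j < k)%N ->
    `|iter (j * n) T (ergodic_average T x n) - ergodic_average T x n| <= e) ->
  `|ergodic_average T x (k * n) - ergodic_average T x n| <= e.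
Proof.
move=> k0 n0 He; set u := ergodic_average T x n.
have kR : 0 < k%:R :> R by rewrite ltr0n.
have nR : n%:R != 0 :> R by rewrite pnatr_eq0 -lt0n.
have E : k%:R *: (ergodic_average T x (k * n) - u) =
    \sum_(0 <= j < k) (iter (j * n) T u - u).
  rewrite sumrB sumr_const_nat subn0 -[u *+ k]scaler_nat scalerBr; congr (_ - _).
  apply: (scalerI nR); rewrite [LHS]scalerA -natrM mulnC -psumE psum_mul scaler_sumr.
  by apply: eq_bigr => j _; rewrite psumE iter_linearZ.
rewrite -(ler_pM2l kR) -[X in X * `|_|]normr_nat -normrZ E.
apply: le_trans (ler_norm_sum _ _ _) _.
rewrite mulr_natl -[k in leRHS]subn0 -sumr_const_nat !big_nat.
by apply: ler_sum => j /andP[_ jk]; exact: He.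
Qed.

(** Writing [a] for the averages, [(m + r) (a (m + r) - a m) = T^m (psum x r) - r (a m)], and each
    term on the right has norm at most [r |x|]. *)
Lemma average_add_dist_le x m r :
  (m + r)%:R * `|ergodic_average T x (m + r) - ergodic_average T x m| <=
  2 * r%:R * `|x|.
Proof.
have -> : (m + r)%:R * `|ergodic_average T x (m + r) - ergodic_average T x m| =
    `|iter m T (psum x r) - r%:R *: ergodic_average T x m|.
  rewrite -[X in X * `|_|]normr_nat -normrZ scalerBr -psumE psum_add psumE.
  by rewrite natrD scalerDl opprD addrACA subrr add0r.
have := ler_normB (iter m T (psum x r)) (r%:R *: ergodic_average T x m).
have := norm_iter_le m (psum x r); have := norm_psum_le x r.
have : `|(r%:R : R) *: ergodic_average T x m| <= r%:R * `|x|.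
  by rewrite normrZ normr_nat ler_wpM2l // norm_average_le.
lra.
Qed.

End Averages.

(** * Growth of the bound functions and the search for an index without a drop *)

Section Bounds.
Variables (R : realType) (eps b : R) (g : nat -> nat).

Lemma bound_htilde_le : {homo bound_htilde eps g b : m n / (m <= n)%N}.
Proof.
move=> m n mn; rewrite /bound_htilde (@big_cat_nat _ _ _ m.+1 1 n.+1) //=.
exact: leq_maxl.
Qed.

Lemma bound_h_le_htilde n : (0 < n)%N ->
  (bound_h eps g b n <= bound_htilde eps g b n)%N.
Proof. by move=> n0; rewrite /bound_htilde big_nat_recr //= leq_maxr. Qed.

Lemma bound_h_gt n : 0 < b -> 0 < eps -> (0 < n)%N ->
  (n < bound_h eps g b n)%N.
Proof.
move=> b0 e0 n0; rewrite /bound_h.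
have : (0 < bound_M eps b)%N by rewrite ceil_nat_gt0 // divr_gt0 // mulr_gt0.
nia.
Qed.

End Bounds.

(* The search starts at 1 and moves to a witness of failure; the bound on the
   norms would become negative after more than [K] steps. *)
Lemma exists_no_drop (R : realType) (eps b gamma : R) (g : nat -> nat)
    (f : nat -> R) :
  0 < b -> 0 < eps -> 0 < gamma -> (forall n, 0 <= f n) -> f 1%N <= b ->
  exists N : nat,
    [/\ (0 < N)%N, (N <= iter (bound_K b gamma) (bound_htilde eps g b) 1)%N &
        forall m, (0 < m <= bound_h eps g b N)%N -> f N - gamma < f m].
Proof.
move=> b0 e0 gam0 f_ge0 f1; apply: contrapT => noN.
pose H := bound_htilde eps g b.
have H_ge n : (0 < n)%N -> (n <= H n)%N.
  move=> n0; apply: leq_trans (bound_h_le_htilde _ _ _ n0).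
  exact/ltnW/bound_h_gt.
have iterH_gt0 k : (0 < iter k H 1)%N.
  by elim: k => //= k IH; exact: leq_trans IH (H_ge _ IH).
have iterH_le : {homo (fun k => iter k H 1%N) : k l / (k <= l)%N}.
  by apply: homo_leq => [//|//|k]; [exact: leq_trans | exact: H_ge].
(* [K] drops only force [f N <= 0]; drop [K + 1] gives the contradiction. It still starts from an
   index at most [htilde^K(1)], where [noN] applies. *)
have drop k : (k <= (bound_K b gamma).+1)%N -> exists N : nat,
    [/\ (0 < N)%N, (N <= iter k H 1)%N & f N <= b - k%:R * gamma].
  elim: k => [_|k IH kK]; first by exists 1%N; rewrite mul0r subr0.
  have [N [N0 NH fN]] := IH (ltnW kK).
  apply: contrapT => noN'; apply: noN; exists N; split => //.
    by apply: leq_trans NH _; apply: iterH_le; rewrite -ltnS.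
  move=> m /andP[m0 mh]; rewrite ltNge; apply/negP => fm; apply: noN'.
  exists m; split => //=.
    apply: (leq_trans mh); apply: leq_trans (bound_h_le_htilde _ _ _ N0) _.
    exact: bound_htilde_le.
  by rewrite -natr1; lra.
have [N [_ _]] := drop _ (leqnn _).
have : b <= (bound_K b gamma)%:R * gamma.
  by rewrite -ler_pdivrMr //; apply: le_ceil_nat; rewrite divr_ge0 // ltW.
have := f_ge0 N; rewrite -natr1; lra.
Qed.

(** Convexity enters only through the drop by a constant [gamma], so both choices of gamma share
    this argument. *)
Lemma metastable_of_gap (R : realType) (X : normedModType R)
    (T : {linear X -> X}) (hT : forall x : X, `|T x| <= `|x|)
    (b eps gamma : R) (x : X) (g : nat -> nat) :
  0 < b -> 0 < eps -> 0 < gamma -> `|x| <= b ->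
  (forall u v : X, `|u| <= `|v| -> `|v| <= b -> eps / 8 <= `|u - v| ->
    `|(2^-1 : R) *: (u + v)| <= `|v| - gamma) ->
  exists P : nat,
    [/\ (0 < P)%N, (P <= Phi eps g b gamma)%N &
        forall i j : nat, (P <= i <= P + g P)%N -> (P <= j <= P + g P)%N ->
          `|ergodic_average T x i - ergodic_average T x j| < eps].
Proof.
move=> b0 e0 gam0 xb gap; set a := ergodic_average T x.
have ab n : `|a n| <= b by apply: le_trans (norm_average_le hT x n) xb.
have [N [N0 NH noDrop]] :=
  exists_no_drop g b0 e0 gam0 (fun n => normr_ge0 (a n)) (ab 1%N).
have M_ge : 16 * b / eps <= (bound_M eps b)%:R.
  by apply: le_ceil_nat; rewrite divr_ge0 ?mulr_ge0 // ltW.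
have M0 : (0 < bound_M eps b)%N by rewrite ceil_nat_gt0 // divr_gt0 // mulr_gt0.
set M := bound_M eps b in M_ge M0 *.
have near_iter k : (k * N <= M * N + g (M * N))%N ->
    `|iter (k * N) T (a N) - a N| <= eps / 8.
  case: k => [|k] kP; first by rewrite mul0n subrr normr0; lra.
  rewrite leNgt; apply/negP => far.
  have := gap _ _ (norm_iter_le hT (k.+1 * N) (a N)) (ab N) (ltW far).
  have := @norm_average_double_le _ _ _ hT x k.+1 N isT N0; rewrite -/a.
  (* The factor 2 in [bound_h] keeps this doubled index in the range of [noDrop]. *)
  have := noDrop (2 * (k.+1 * N))%N.
  rewrite /bound_h -/M leq_mul2l kP orbT !muln_gt0 N0 /= => /(_ isT).
  lra.
have near i : (M * N <= i <= M * N + g (M * N))%N -> `|a i - a N| <= eps / 4.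
  move=> /andP[Mi iP].
  have iE := divn_eq i N; set k := (i %/ N)%N in iE; set r := (i %% N)%N in iE.
  have rN : (r < N)%N by rewrite ltn_mod.
  have k0 : (0 < k)%N by rewrite divn_gt0 //; nia.
  have akN : `|a (k * N)%N - a N| <= eps / 8.
    apply: (average_mul_dist_le k0 N0) => j jk.
    by apply: near_iter; nia.
  have aik : `|a i - a (k * N)%N| <= eps / 8.
    have := average_add_dist_le hT x (k * N) r; rewrite -iE -/a => dist.
    have iR : M%:R * N%:R <= i%:R :> R by rewrite -natrM ler_nat.
    have rR : r%:R <= N%:R :> R by rewrite ler_nat ltnW.
    have NR : 0 < N%:R :> R by rewrite ltr0n.
    have eM : 16 * b <= M%:R * eps by rewrite -ler_pdivrMr.
    have i0 : 0 < i%:R :> R by rewrite ltr0n; nia.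
    rewrite -(ler_pM2l i0); apply: (le_trans dist).
    apply: (@le_trans _ _ (2 * N%:R * b)).
      by apply: ler_pM; rewrite ?mulr_ge0 // ler_wpM2l.
    (* The constant 16 in [M] is what gives [2 b <= M eps / 8]. *)
    apply: (@le_trans _ _ (M%:R * N%:R * (eps / 8))); first by nra.
    by rewrite ler_wpM2r //; lra.
  by have := ler_distD (a (k * N)%N) (a i) (a N); lra.
exists (M * N)%N; split=> [||i j /near ai /near aj]; first by rewrite muln_gt0 M0.
  by rewrite /Phi leq_mul2l NH orbT.
have := ler_distD (a N) (a i) (a j); rewrite [`|a N - _|]distrC; lra.
Qed.

Theorem theorem2p1 (R : realType) (X : completeNormedModType R)
    (hX : uniformly_convex X)
    (eta : R -> R) (heta : convexity_modulus X eta)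
    (T : {linear X -> X}) (hT : forall x : X, `|T x| <= `|x|)
    (b : R) (hb : 0 < b) :
  ergodic_metastable T b (gamma_modulus eta)
  /\
  (forall etat : R -> R,
     (forall eps : R, 0 < eps -> 0 < etat eps) ->
     (forall eps1 eps2 : R, 0 < eps1 -> eps1 <= eps2 ->
        etat eps1 <= etat eps2) ->
     (forall eps : R, 0 < eps <= 2 -> eta eps = eps * etat eps) ->
     ergodic_metastable T b (gamma_factored etat)).
Proof.
have e8b (eps : R) : eps / (8 * b) = eps / 8 / b by rewrite invfM mulrA.
split=> [|etat etat_gt0 etat_le etaE] x xb eps e0 g _;
  have e8 : 0 < eps / 8 by rewrite divr_gt0.
- apply: metastable_of_gap => // [|u v uv vb euv].
    rewrite /gamma_modulus /extend_modulus mulr_gt0 ?divr_gt0 //.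
    (* Gamma must be positive even when [eps / (8 * b)] exceeds 2, hence the truncated argument. *)
    have [|/andP[]//] := heta (Num.min 2 (eps / (8 * b))).
    by rewrite lt_min ge_min lexx e8b divr_gt0 // ltr0n.
  have [_ + _] := midpoint_le_bounded heta hb e8 uv vb euv.
  rewrite /gamma_modulus e8b; have -> : eps / 8 / 2 = eps / 16 by field.
  by [].
- apply: metastable_of_gap => // [|u v uv vb euv].
    by rewrite /gamma_factored mulr_gt0 // etat_gt0 // divr_gt0 // mulr_gt0.
  have [e2v _ +] := midpoint_le_bounded heta hb e8 uv vb euv.
  have v0 : 0 < `|v| by lra.
  (* The factor [|v|] cancels, leaving [eps / 8 * etat (eps / 8 / |v|)]; since [|v| <= b],
     monotonicity of [etat] allows replacing [|v|] by [b]. No bound [|v| >= eps / 16] is spent,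
     which gains the factor 2. *)
  rewrite etaE; last by rewrite divr_gt0 //= ler_pdivrMr.
  rewrite mulrA [`|v| * _]mulrC divfK ?gt_eqF // => /le_trans; apply.
  rewrite /gamma_factored e8b lerB // ler_wpM2l ?(ltW e8) // etat_le ?divr_gt0 //.
  by rewrite ler_wpM2l ?(ltW e8) // lef_pV2.
Qed.
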